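(* There is no constant $c$ such that every series parallel graph has two $c$-orthogonal path decompositions.
   Context: A series parallel graph is a graph with no $K_4$ minor (equivalently, of treewidth at most 2). A path decomposition of $G$ is a sequence of bags (subsets of $V(G)$) such that every edge has both ends in some bag and the bags containing any given vertex form a non-empty consecutive subsequence. Two path decompositions $A$ and $B$ of $G$ are $c$-orthogonal if $|A_x\cap B_y|\le c$ for every bag $A_x$ of $A$ and $B_y$ of $B$. *)

(* Defs.v *)
From mathcomp Require Import all_boot.

Set Implicit Arguments.
Unset Strict Implicit.
Unset Printing Implicit Defensive.

Record sgraph := SGraph {
  vertex :> finType;
  adj : rel vertex;
  adj_sym : symmetric adj;
  adj_irrefl : irreflexive adj
}.

Lemma complete_sym n : symmetric (fun i j : 'I_n => i != j).
Proof. by move=> i j; rewrite eq_sym. Qed.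

Lemma complete_irrefl n : irreflexive (fun i j : 'I_n => i != j).
Proof. by move=> i; rewrite eqxx. Qed.

Definition complete (n : nat) : sgraph :=
  SGraph (@complete_sym n) (@complete_irrefl n).

(* The subgraph of G induced by S is nonempty and connected. *)
Definition connected_in (G : sgraph) (S : {set G}) : Prop :=
  S != set0 /\
  {in S &, forall x y,
     connect [rel u v | [&& u \in S, v \in S & adj u v]] x y}.

(* H is a minor of G, by means of branch sets: contracting each [phi i] to a
   vertex and deleting the remaining vertices and superfluous edges yields H. *)
Definition minor (H G : sgraph) : Prop :=
  exists phi : H -> {set G},
    [/\ forall i, connected_in (phi i),
        forall i j, i != j -> [disjoint phi i & phi j]
      & forall i j, adj i j ->
          exists x y, [/\ x \in phi i, y \in phi j & adj x y]].

Definition series_parallel (G : sgraph) : Prop := ~ minor (complete 4) G.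

(* The bags containing v are exactly those at positions a, a+1, ..., b. *)
Definition path_decomposition (G : sgraph) (P : seq {set G}) : Prop :=
  (forall x y : G, adj x y -> exists2 X, X \in P & (x \in X) && (y \in X)) /\
  (forall v : G, exists a b : nat,
     [/\ a <= b, b < size P
       & forall k, k < size P -> (v \in nth set0 P k) = (a <= k <= b)]).

Definition orthogonal (G : sgraph) (c : nat) (A B : seq {set G}) : Prop :=
  forall X Y, X \in A -> Y \in B -> #|X :&: Y| <= c.

(* Main.v *)
Require Import Defs.
From mathcomp Require Import all_boot.
From mathcomp Require Import zify.

Set Implicit Arguments.
Unset Strict Implicit.
Unset Printing Implicit Defensive.

(** Two c-orthogonal path decompositions represent G by axis-parallel boxes in
    the plane (the sets of positions of the bags containing a vertex) such that
    adjacent vertices have intersecting boxes and no point lies in more than c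
    boxes.  Start from an edge and repeatedly stack 4c+1 new vertices on every
    edge; the result stays free of K_4 minors.  Among the vertices stacked on an
    edge uv, one avoids the four corners of the intersection of the boxes of u
    and v, hence is squeezed inside that intersection along one axis.  Following
    such squeezed vertices from one level of the construction to the next, we
    accumulate a set K of boxes with a common point and a set L of boxes each
    containing one of two fixed points.  Each level enlarges K (possibly
    resetting L) or enlarges L while keeping the size of K; since |K| <= c and
    |L| <= 2c, the quantity (2c+1)|K| + |L| cannot grow forever. *)

(** * Stacking on edges and $K_4$ minors *)

Section Stack.

Variables (G : sgraph) (N : nat).

(* A triple [(a, b, j)] is the [j]-th vertex stacked on the edge [ab]; it is
   isolated when [ab] is not an edge. *)
Definition stack_vertex : finType := (G + G * G * 'I_N)%type.

Definition stack_adj : rel stack_vertex := fun x y =>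
  match x, y with
  | inl u, inl v => adj u v
  | inl u, inr (a, b, _) => adj a b && (u \in [:: a; b])
  | inr (a, b, _), inl u => adj a b && (u \in [:: a; b])
  | inr _, inr _ => false
  end.

Lemma stack_sym : symmetric stack_adj.
Proof. by move=> [u|[[a b] j]] [v|[[a' b'] j']] //=; rewrite adj_sym. Qed.

Lemma stack_irrefl : irreflexive stack_adj.
Proof. by move=> [u|[[a b] j]] //=; rewrite adj_irrefl. Qed.

Definition stack : sgraph := SGraph stack_sym stack_irrefl.

End Stack.

Lemma connected_in_neighbour (G : sgraph) (S : {set G}) x y :
  connected_in S -> x \in S -> y \in S -> x != y ->
  exists2 z, z \in S & adj x z.
Proof.
move=> [_ conS] xS yS neq; have /connectP[[|z s] /=] := conS x y xS yS.
  by move=> _ eq_yx; rewrite eq_yx eqxx in neq.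
by move=> /andP[/and3P[_ zS xz] _] _; exists z.
Qed.

Definition old_part (G : sgraph) N (S : {set stack G N}) : {set G} :=
  [set u | inl u \in S].

(* A stacked vertex of [S] can be bypassed along the edge it is stacked on, so
   [S] retracts onto its old part. *)
Lemma connected_old_part (G : sgraph) N (S : {set stack G N}) :
  connected_in S -> old_part S != set0 -> connected_in (old_part S).
Proof.
move=> [_ conS] S0; split=> // u v; rewrite !inE => uS vS.
(* The value [b] may lie outside [S], but only when the stacked vertex has no neighbour in [S]. *)
pose r (x : stack G N) : G :=
  match x with inl w => w
             | inr (a, b, _) => if (inl a : stack G N) \in S then a else b end.
have step (x y : stack G N) : x \in S -> y \in S -> adj x y ->
    connect [rel u v | [&& u \in old_part S, v \in old_part S & adj u v]]
            (r x) (r y).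
  case: x y => [w|[[a b] j]] [w'|[[a' b'] j']] //= xS yS.
  - by move=> ww'; apply: connect1; rewrite /= !inE xS yS.
  - case/andP=> ab; rewrite !inE => /orP[]/eqP eqw; subst w.
      by rewrite xS connect0.
    case: ifP => aS; last exact: connect0.
    by apply: connect1; rewrite /= !inE xS aS adj_sym.
  case/andP=> ab; rewrite !inE => /orP[]/eqP eqw; subst w'.
    by rewrite yS connect0.
  case: ifP => aS; last exact: connect0.
  by apply: connect1; rewrite /= !inE yS aS.
have /connectP[s sP eq_v] := conS _ _ uS vS.
rewrite -[u]/(r (inl u)) -[v]/(r (inl v)) {}eq_v.
elim: s (inl u : stack G N) sP => [|y s IHs] x /=; first by rewrite connect0.
case/andP=> /and3P[xS yS xy] /IHs.
exact: connect_trans (step _ _ xS yS xy).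
Qed.

(** Stacked vertices are pairwise non-adjacent, so a branch set without old vertices is a single
    stacked vertex; its two neighbours cannot serve three other disjoint branch sets. *)
Lemma old_part_neq0 (G : sgraph) N (phi : 'I_4 -> {set stack G N}) i :
  (forall i, connected_in (phi i)) ->
  (forall i j, i != j -> [disjoint phi i & phi j]) ->
  (forall i j, i != j -> exists x y, [/\ x \in phi i, y \in phi j & adj x y]) ->
  old_part (phi i) != set0.
Proof.
move=> conP disP adjP; apply/eqP => old0.
have noold u : (inl u : stack G N) \notin phi i.
  by move/setP/(_ u): old0; rewrite !inE => ->.
have [/set0Pn[[u|[[a b] j]] xS] _] := conP i; first by rewrite (negPf (noold u)) in xS.
have ends k : k != i -> (inl a \in phi k) || (inl b \in phi k).
  rewrite eq_sym => /adjP[y [z [yS zS yz]]].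
  have eq_y : y = inr (a, b, j).
    apply/eqP/negPn/negP => neq.
    have [w wS] := connected_in_neighbour (conP i) yS xS neq.
    case: w y yS {yz neq} wS => [w|w] [y|[[a' b'] j']] //= yS wS.
    - by rewrite (negPf (noold w)) in wS.
    - by rewrite (negPf (noold w)) in wS.
    - by rewrite (negPf (noold y)) in yS.
  move: yz; rewrite {}eq_y; case: z zS => [z|[[a' b'] j']] //= zS.
  by case/andP=> _; rewrite !inE => /orP[]/eqP <-; rewrite zS ?orbT.
have uniqP (x : stack G N) k l : x \in phi k -> x \in phi l -> k = l.
  move=> xk xl; apply/eqP/negPn/negP => /disP dkl.
  by have := disjointFr dkl xk; rewrite xl.
pose f k := (inl a : stack G N) \in phi k.
have f_inj : {in [set~ i] &, injective f}.
  move=> k l; rewrite !inE /f => /ends kE /ends lE eq_f.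
  case: (boolP (inl a \in phi k)) => [ka|/negPf ka].
    by move: eq_f; rewrite ka => /esym la; exact: uniqP ka la.
  by move: kE lE; rewrite -eq_f ka /= => kb lb; exact: uniqP kb lb.
have := max_card (mem (f @: [set~ i])).
by rewrite (card_in_imset f_inj) cardsC1 card_ord card_bool.
Qed.

Lemma stack_series_parallel (G : sgraph) N :
  series_parallel G -> series_parallel (stack G N).
Proof.
move=> spG [phi [conP disP adjP]]; apply: spG.
have old0 i := old_part_neq0 i conP disP adjP.
exists (fun i => old_part (phi i)); split.
- by move=> i; apply: connected_old_part.
- move=> i j ij; rewrite -setI_eq0; apply/eqP/setP=> u; rewrite !inE.
  by apply/negP => /andP[ui]; rewrite (disjointFr (disP _ _ ij) ui).
(* Both [u] and a neighbour of the stacked vertex inside [phi j] are ends of the edge stacked upon;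
   being distinct, they are adjacent. *)
have half i j (u : G) (x : G * G * 'I_N) : i != j ->
    inl u \in phi i -> inr x \in phi j -> adj (inl u : stack G N) (inr x) ->
    exists2 v, v \in old_part (phi j) & adj u v.
  case: x => [[a b] k] ij ui xj ux.
  have /set0Pn[o] := old0 j; rewrite inE => oj.
  have [//|[w|[[a' b'] k']] wj //=] := connected_in_neighbour (conP j) xj oj.
  move=> /andP[ab]; move: ux => /= /andP[_].
  have neq : u != w.
    by apply: contraTneq wj => <-; rewrite (disjointFr (disP _ _ ij) ui).
  rewrite !inE => /orP[]/eqP equ /orP[]/eqP eqw; subst u w.
  - by rewrite eqxx in neq.
  - by exists b; rewrite ?inE.
  - by exists a; rewrite ?inE // adj_sym.
  - by rewrite eqxx in neq.
move=> i j ij; have [x [y [xi yj xy]]] := adjP i j ij.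
case: x xi xy => [u|x] xi; case: y yj => [v|y] yj xy.
- by exists u, v; rewrite !inE.
- by have [v vj uv] := half i j u y ij xi yj xy; exists u, v; rewrite inE.
- have [||w wi vw] := half j i v x _ yj xi; rewrite 1?eq_sym 1?adj_sym //.
  by exists w, v; rewrite (adj_sym w v) [v \in _]inE.
- by case: x y xi yj xy => [[a b] k] [[a' b'] k'].
Qed.

Fixpoint tower (N d : nat) : sgraph :=
  if d is d'.+1 then stack (tower N d') N else complete 2.

Lemma tower_series_parallel N d : series_parallel (tower N d).
Proof.
elim: d => [|d IHd]; last exact: stack_series_parallel.
(* Four disjoint non-empty branch sets do not fit into two vertices. *)
move=> [phi [conP disP _]].
have /fin_all_exists[f fP] : forall i, exists x, x \in phi i.
  by move=> i; have [/set0Pn] := conP i.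
have f_inj : injective f.
  move=> i j eq_f; apply/eqP/negPn/negP => /disP dij.
  by have := disjointFr dij (fP i); rewrite eq_f fP.
by have := leq_card f f_inj; rewrite !card_ord.
Qed.

(** * Box representations and telescopes *)

Section Boxes.

Variable (G : sgraph).
Implicit Types (lo hi : bool -> G -> nat) (b : bool) (n : nat) (u v : G).

(* The two axes are indexed by [bool]: the box of [v] is the product of the
   intervals [lo b v, hi b v] over both values of [b]. *)
Definition covers lo hi b n v := lo b v <= n <= hi b v.

Definition nested lo hi b u v := (lo b v <= lo b u) && (hi b u <= hi b v).

Definition box_representation c lo hi : Prop :=
  [/\ forall b v, lo b v <= hi b v,
      forall b u v, adj u v -> lo b u <= hi b v
    & forall b m n,
        #|[set v | covers lo hi b m v && covers lo hi (~~ b) n v]| <= c].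

Definition touches_end lo hi b p v :=
  covers lo hi b (lo b p) v || covers lo hi b (hi b p) v.

(* All boxes of [K] contain the product of the [b]-interval of [z] and the other
   interval of [p]; all boxes of [L] contain the product of the [b]-interval of
   [z] and one of the two ends of the other interval of [p]. *)
Definition telescope lo hi b p z (K L : {set G}) : Prop :=
  [/\ adj p z, z \notin K, z \notin L,
      {in K, forall a, nested lo hi b z a && nested lo hi (~~ b) p a}
    & {in L, forall a, nested lo hi b z a && touches_end lo hi (~~ b) p a}].

(** One common point lies in all boxes of [K], and two points together meet all boxes of [L]. *)
Lemma telescope_bound c lo hi b p z K L :
  box_representation c lo hi -> telescope lo hi b p z K L ->
  #|K| <= c /\ #|L| <= c.*2.
Proof.
move=> [lohi _ ply] [_ _ _ KP LP]; have zb := lohi b z; have pb := lohi (~~ b) p.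
split.
  apply: leq_trans (ply b (lo b z) (lo (~~ b) p)); apply/subset_leq_card/subsetP.
  by move=> a /KP; rewrite inE /covers /nested; lia.
pose C n := [set v | covers lo hi b (lo b z) v && covers lo hi (~~ b) n v].
have sub : L \subset C (lo (~~ b) p) :|: C (hi (~~ b) p).
  by apply/subsetP=> a /LP; rewrite !inE /touches_end /covers /nested; lia.
apply: leq_trans (subset_leq_card sub) _; apply: leq_trans (leq_card_setU _ _) _.
by rewrite -addnn; apply: leq_add; apply: ply.
Qed.

(* A box that meets the boxes of [u] and [v] but contains none of the four
   corners of their intersection is nested in both along some axis. *)
Lemma inner_child c lo hi u v (T : {set G}) :
  box_representation c lo hi -> c.*2.*2 < #|T| ->
  {in T, forall t, adj u t && adj v t} ->
  exists2 t, t \in T &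
    exists b, nested lo hi b t u && nested lo hi b t v.
Proof.
move=> [_ meet ply] cT TP.
pose l b := maxn (lo b u) (lo b v); pose h b := minn (hi b u) (hi b v).
pose C m n := [set w | covers lo hi true m w && covers lo hi false n w].
pose corners := (C (l true) (l false) :|: C (l true) (h false))
            :|: (C (h true) (l false) :|: C (h true) (h false)).
have card2 (X Y : {set G}) k : #|X| <= k -> #|Y| <= k -> #|X :|: Y| <= k.*2.
  move=> Xk Yk; apply: leq_trans (leq_card_setU _ _) _.
  by rewrite -addnn leq_add.
have cardC : #|corners| <= c.*2.*2 by apply: (card2 _ _ c.*2); apply: (card2 _ _ c); apply: ply.
have /subsetPn[t tT tC] : ~~ (T \subset corners).
  by apply: contraL cT => /subset_leq_card TC; rewrite -leqNgt (leq_trans TC).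
have /andP[ut vt] := TP t tT.
have [tu tv] : adj t u /\ adj t v by rewrite ![adj t _]adj_sym.
exists t => //.
have alt b : [|| nested lo hi b t u && nested lo hi b t v,
                 covers lo hi b (l b) t | covers lo hi b (h b) t].
  move: (meet b _ _ ut) (meet b _ _ vt) (meet b _ _ tu) (meet b _ _ tv).
  by rewrite /nested /covers /l /h; lia.
have /orP[?|tx] := alt true; first by exists true.
have /orP[?|ty] := alt false; first by exists false.
by move: tC; rewrite !inE; case/orP: tx => ->; case/orP: ty => ->; rewrite ?orbT.
Qed.

End Boxes.

(** * Growth of telescopes along the tower *)

Lemma restrict_box_representation (G : sgraph) N c lo hi :
  @box_representation (stack G N) c lo hi ->
  @box_representation G c (fun b v => lo b (inl v)) (fun b v => hi b (inl v)).
Proof.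
move=> [lohi meet ply]; split=> [b v|b u v uv|b m n]; first exact: lohi.
  exact: meet.
apply: leq_trans (ply b m n).
rewrite -(card_imset _ (@inl_inj _ (G * G * 'I_N))).
by apply/subset_leq_card/subsetP=> _ /imsetP[v + ->]; rewrite !inE.
Qed.

(* Let [t] be a vertex stacked on [pz] and nested in both along some axis. If
   this axis is not [b], then [z] joins [K] and the next edge is [zt]. If it is
   [b], then either [z] reaches an end of the other interval of [p], and [z]
   joins [L] with next edge [pt], or that interval of [z] lies inside the one of
   [p], and [z] joins [K] with next edge [zt]. *)
Lemma telescope_step (G : sgraph) c lo hi b p z (K L : {set G}) :
  @box_representation (stack G c.*2.*2.+1) c lo hi ->
  telescope (fun b v => lo b (inl v)) (fun b v => hi b (inl v)) b p z K L ->
  exists b' p' z' (K' L' : {set stack G c.*2.*2.+1}),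
    telescope lo hi b' p' z' K' L' /\
    (#|K| < #|K'| \/ #|K'| = #|K| /\ #|L| < #|L'|).
Proof.
set N := c.*2.*2.+1; pose i : G -> stack G N := inl; move=> rep [pz zK zL KP LP].
have {}KP k : k \in K ->
    nested lo hi b (i z) (i k) && nested lo hi (~~ b) (i p) (i k).
  exact: KP.
have {}LP k : k \in L ->
    nested lo hi b (i z) (i k) && touches_end lo hi (~~ b) (i p) (i k).
  exact: LP.
pose old (S : {set G}) : {set stack G N} := i @: S.
have old_card S : #|old S| = #|S| by apply: card_imset; exact: inl_inj.
have old_mem S u : (i u \in old S) = (u \in S) by apply: mem_imset; exact: inl_inj.
have old_new S x : (inr x \in old S) = false by apply/imsetP => -[].
pose T : {set stack G N} := [set inr (p, z, j) | j : 'I_N].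
have cT : c.*2.*2 < #|T| by rewrite card_imset ?card_ord // => j k [].
have TP : {in T, forall t, adj (i p) t && adj (i z) t}.
  by move=> _ /imsetP[j _ ->] /=; rewrite pz !inE !eqxx orbT.
have [t tT [b' tP]] := inner_child rep cT TP.
have /andP[pt zt] := TP t tT.
have tnew S : t \notin old S.
  by case/imsetP: tT => j _ ->; rewrite old_new.
have tnewU S : t \notin i z |: old S.
  by rewrite !inE negb_or tnew andbT; case/imsetP: tT => j _ ->.
have growK : #|K| < #|i z |: old K|.
  by rewrite cardsU1 old_mem zK old_card.
have [meet1 meet2] : lo (~~ b) (i p) <= hi (~~ b) (i z) /\
                     lo (~~ b) (i z) <= hi (~~ b) (i p).
  by case: rep => _ meet _; split; apply: meet; rewrite //= adj_sym.
case: (eqVneq b' b) => [eq_b|/negPf neq_b]; last first.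
  have {neq_b} eq_b : b' = ~~ b by case: b b' neq_b {KP LP tP meet1 meet2} => [] [].
  exists b', (i z), t, (i z |: old K), set0; split; last by left.
  split; rewrite ?tnewU ?inE //; last by move=> a; rewrite inE.
  move=> a; rewrite in_setU1 => /predU1P[->|/imsetP[k /KP kP ->]].
    by case/andP: tP => _ ->; rewrite /nested !leqnn.
  by move: tP kP; rewrite eq_b negbK /nested /=; lia.
subst b'.
have [touch|inside] := boolP (touches_end lo hi (~~ b) (i p) (i z)).
  exists b, (i p), t, (old K), (i z |: old L); split; last first.
    by right; rewrite cardsU1 old_mem zL !old_card.
  split; rewrite ?tnewU ?tnew //.
    move=> _ /imsetP[k /KP kP ->].
    by move: tP kP; rewrite /nested /=; lia.
  move=> a; rewrite in_setU1 => /predU1P[->|/imsetP[k /LP kP ->]].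
    by rewrite touch andbT; case/andP: tP.
  by move: tP kP; rewrite /nested /touches_end /covers /=; lia.
exists b, (i z), t, (i z |: old K), set0; split; last by left.
split; rewrite ?tnewU ?inE //; last by move=> a; rewrite inE.
move=> a; rewrite in_setU1 => /predU1P[->|/imsetP[k /KP kP ->]].
  by case/andP: tP => _ ->; rewrite /nested !leqnn.
by move: tP kP inside; rewrite /nested /touches_end /covers /=; lia.
Qed.

Lemma telescope_exists c d lo hi :
  @box_representation (tower c.*2.*2.+1 d) c lo hi ->
  exists b p z K L, telescope lo hi b p z K L /\
    d <= #|K| * c.*2.+1 + #|L|.
Proof.
elim: d lo hi => [|d IHd] lo hi rep.
  exists true, ord0, ord_max, set0, set0; split=> //.
  by split; rewrite ?inE // => a; rewrite inE.
have rep' := restrict_box_representation rep.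
have [b [p [z [K [L [tel dle]]]]]] := IHd _ _ rep'.
have [_ Lc] := telescope_bound rep' tel.
have [b' [p' [z' [K' [L' [tel' grow]]]]]] := telescope_step rep tel.
exists b', p', z', K', L'; split=> //.
(* A larger [K] gains at least [2c+1], which outweighs the at most [2c] lost with [L]. *)
apply: leq_ltn_trans dle _; case: grow => [Kgrow|[-> Lgrow]].
  have := leq_mul Kgrow (leqnn c.*2.+1); rewrite mulSn => Kbig.
  by apply: leq_trans (leq_addr _ _); apply: leq_trans Kbig; rewrite addnC ltn_add2r ltnS.
by rewrite ltn_add2l.
Qed.

(** The depth is [c(2c+1) + 2c + 1], one more than the bounds on [K] and [L] allow. *)
Lemma no_box_representation c lo hi :
  ~ @box_representation (tower c.*2.*2.+1 (c.+1 * c.*2.+1)) c lo hi.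
Proof.
move=> rep; have [b [p [z [K [L [tel]]]]]] := telescope_exists rep.
have [Kc Lc] := telescope_bound rep tel.
have := leq_mul Kc (leqnn c.*2.+1); lia.
Qed.

(** * From orthogonal path decompositions to boxes *)

Lemma path_decomposition_intervals (G : sgraph) (P : seq {set G}) :
  path_decomposition P ->
  exists lo hi : G -> nat,
    [/\ forall v, lo v <= hi v, forall u v, adj u v -> lo u <= hi v
      & forall v n, lo v <= n <= hi v -> n < size P /\ v \in nth set0 P n].
Proof.
move=> [edgeP bagP].
have /fin_all_exists[lo /fin_all_exists[hi loP]] := bagP.
exists lo, hi; split=> [v|u v uv|v n nP]; first by case: (loP v).
  have [X /(nthP set0)[n nP <-] /andP[uX vX]] := edgeP u v uv.
  have [_ _ /(_ n nP)] := loP u; have [_ _ /(_ n nP)] := loP v.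
  by rewrite uX vX; lia.
have [_ hiP nthE] := loP v.
have nlt : n < size P by lia.
by rewrite nthE.
Qed.

Lemma orthogonal_box_representation (G : sgraph) c (A B : seq {set G}) :
  path_decomposition A -> path_decomposition B -> orthogonal c A B ->
  exists lo hi, @box_representation G c lo hi.
Proof.
move=> /path_decomposition_intervals[la [ha [lhA meetA bagA]]].
move=> /path_decomposition_intervals[lb [hb [lhB meetB bagB]]] orth.
exists (fun b => if b then la else lb), (fun b => if b then ha else hb).
have ply m n : #|[set v | (la v <= m <= ha v) && (lb v <= n <= hb v)]| <= c.
  (* Orthogonality speaks only of actual bags; a box through the point shows that both positions are
     in range. *)
  set S := [set v | _]; have [->|/set0Pn[w]] := eqVneq S set0; first by rewrite cards0.
  rewrite inE => /andP[/bagA[mA _] /bagB[nB _]].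
  apply: leq_trans (orth _ _ (mem_nth set0 mA) (mem_nth set0 nB)).
  apply/subset_leq_card/subsetP=> v; rewrite !inE.
  by case/andP=> /bagA[_ ->] /bagB[_ ->].
split=> [[] v|[] u v uv|[] m n]; [exact: lhA|exact: lhB|exact: meetA|exact: meetB|exact: ply|].
apply: leq_trans (ply n m); apply/subset_leq_card/subsetP=> v.
by rewrite !inE andbC.
Qed.

Theorem theorem29 :
  ~ exists c : nat, forall G : sgraph, series_parallel G ->
      exists A B : seq {set G},
        [/\ path_decomposition A, path_decomposition B & orthogonal c A B].
Proof.
move=> [c allG].
have [A [B [pdA pdB orth]]] := allG _ (@tower_series_parallel c.*2.*2.+1 (c.+1 * c.*2.+1)).
have [lo [hi rep]] := orthogonal_box_representation pdA pdB orth.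
exact: no_box_representation rep.
Qed.
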